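(* Suppose $X_1,\dots,X_n$ are iid random variables with common distribution function $F$, and let $X_{1:n}\le X_{2:n}\le\dots\le X_{n:n}$ be the order statistics of this sample. If $F$ is strictly increasing and continuous on its support, then the random closed sets $$\mathcal{T}_n:=\Bigl\{\Bigl(F^{\leftarrow}\bigl(\tfrac{i}{n+1}\bigr),X_{i:n}\Bigr): 1\le i\le n\Bigr\}$$ converge in probability, as $n\to\infty$, to the non-random closed set $$\mathcal{T}:=\{(x,x): x\in \mathrm{support}(F)\}$$ in $\mathcal{F}_2$.
   Context: For $0<p<1$, $F^{\leftarrow}(p):=\inf\{x: F(x)\ge p\}$. $\mathcal{F}_2$ is the space of all closed subsets of $\mathbb{R}^2$ with the Fell topology, whose sub-base consists of the families $\{A \text{ closed}: A\cap K=\emptyset\}$ for $K$ compact and $\{A\text{ closed}: A\cap G\ne\emptyset\}$ for $G$ open. This topology is metrizable; convergence in probability in $\mathcal{F}_2$ means $d_{\mathcal F}(\mathcal{T}_n,\mathcal{T})\to 0$ in probability, where $d_{\mathcal F}$ is a metric on $\mathcal{F}_2$ compatible with the Fell topology (since the limit is non-random this is the same as weak convergence of the random closed sets). The support of $F$ is the smallest closed set of full probability. ''Continuous on its support'' means that $F$, as a function on $\mathbb{R}$, is continuous at every point of its support (so $F(X_1)$ is uniform on $(0,1)$ and quantiles $F^{\leftarrow}(p)$ are unique for $0<p<1$). *)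

(* Defs.v *)
From HB Require Import structures.
From mathcomp Require Import all_boot all_order all_algebra.
From mathcomp Require Import finmap.
From mathcomp Require Import all_classical all_reals all_analysis.

Set Implicit Arguments.
Unset Strict Implicit.
Unset Printing Implicit Defensive.

Import Order.TTheory GRing.Theory Num.Theory.
Import numFieldNormedType.Exports.

Local Open Scope classical_set_scope.
Local Open Scope ring_scope.

(* The hyperspace of closed subsets of T; the empty set is a point of it. *)
Record closed_subset (T : topologicalType) := ClosedSubset {
  closed_subset_val :> set T ;
  closed_subsetP : closed closed_subset_val }.

HB.instance Definition _ (T : topologicalType) :=
  gen_eqMixin (closed_subset T).
HB.instance Definition _ (T : topologicalType) :=
  gen_choiceMixin (closed_subset T).
HB.instance Definition _ (T : topologicalType) :=
  isPointed.Build (closed_subset T) (ClosedSubset (@closed0 T)).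

Definition fell_miss (T : topologicalType) (K : set T) :
  set (closed_subset T) := [set A | A `&` K = set0].

Definition fell_hit (T : topologicalType) (G : set T) :
  set (closed_subset T) := [set A | A `&` G !=set0].

Definition fell_subbase (T : topologicalType) :
    set (set (closed_subset T)) :=
  [set fell_miss K | K in [set K | compact K]] `|`
  [set fell_hit G | G in [set G | open G]].

HB.instance Definition _ (T : topologicalType) :=
  isSubBaseTopological.Build (closed_subset T) (@fell_subbase T) id.

Definition compatible_metric (R : realType) (T : topologicalType)
    (d : T -> T -> R) : Prop :=
  [/\ forall x y, d x y = 0 <-> x = y,
      forall x y, d x y = d y x,
      forall x y z, d x z <= d x y + d y z &
      forall x, nbhs x =
        filter_from [set e | 0 < e] (fun e => [set y | d x y < e])].

(* Measurability is part of the notion: the value of P on a set that is not an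
   event is meaningless. *)
Definition cvg_in_probability (disp : measure_display)
    (Omega : measurableType disp) (R : realType) (P : probability Omega R)
    (T : Type) (d : T -> T -> R) (Y : nat -> Omega -> T) (y : T) : Prop :=
  forall e : R, 0 < e ->
    (forall n, measurable [set w | e <= d (Y n w) y]) /\
    P [set w | e <= d (Y n w) y] @[n --> \oo] --> 0%E.

Definition mutually_independent (disp : measure_display)
    (Omega : measurableType disp) (R : realType) (P : probability Omega R)
    (X : nat -> {RV P >-> R}) : Prop :=
  forall (J : {fset nat}) (B : nat -> set R),
    (forall i, measurable (B i)) ->
    P (\bigcap_(i in [set` J]) (X i @^-1` B i)) =
    (\prod_(i <- J) P (X i @^-1` B i))%E.

Definition iid_with_cdf (disp : measure_display)
    (Omega : measurableType disp) (R : realType) (P : probability Omega R)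
    (X : nat -> {RV P >-> R}) (F : R -> R) : Prop :=
  mutually_independent X /\ forall i r, cdf (X i) r = (F r)%:E.

Definition quantile (R : realType) (F : R -> R) (p : R) : R :=
  inf [set x | p <= F x].

(* lebesgue_stieltjes_measure F is the law with distribution function F. *)
Definition cdf_support (R : realType) (F : cumulativeBounded (0 : R) (1 : R)) :
    set R :=
  \bigcap_(C in [set C | closed C /\ lebesgue_stieltjes_measure F C = 1%E]) C.

(* Samples and ranks are counted from 0: the sample of size n is
   x 0, ..., x n.-1, and order_statistic x n i is the (i+1)-th smallest. *)
Definition order_statistic (R : realType) (x : nat -> R) (n i : nat) : R :=
  (sort <=%R (mkseq x n))`_i.

Definition qq_points (R : realType) (F : R -> R) (x : nat -> R) (n : nat) :
    set (R * R) :=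
  [set (quantile F (i.+1%:R / n.+1%:R), order_statistic x n i) | i in `I_n].

Lemma qq_points_closed (R : realType) (F : R -> R) (x : nat -> R) (n : nat) :
  closed (qq_points F x n).
Proof.
move: (qq_points F x n) (finite_image _ (finite_II n) : finite_set (qq_points F x n)).
apply/accessible_finite_set_closed/hausdorff_accessible.
exact: norm_hausdorff.
Qed.

Definition qq_plot (R : realType) (F : R -> R) (x : nat -> R) (n : nat) :
    closed_subset (R * R)%type :=
  ClosedSubset (@qq_points_closed R F x n).

Definition diagonal (R : realType) (S : set R) : set (R * R) :=
  [set (x, x) | x in S].

Lemma diagonal_support_closed (R : realType)
    (F : cumulativeBounded (0 : R) (1 : R)) : closed (diagonal (cdf_support F)).
Proof.
have -> : diagonal (cdf_support F) =
    (fst @^-1` cdf_support F) `&` ((fun z => z.1 - z.2) @^-1` [set 0 : R]).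
  apply/seteqP; split => [_ [x Sx <-]|[x y] /= [Sx /eqP]].
    by split => //=; rewrite subrr.
  by rewrite subr_eq0 => /eqP <-; exists x.
apply: closedI; apply: preimage_closed.
- by move=> z _; exact: cvg_fst.
- by apply: closed_bigI => C [].
- by move=> z _; apply: cvgB; [exact: cvg_fst|exact: cvg_snd].
- exact: closed_eq.
Qed.

Definition diagonal_support (R : realType)
    (F : cumulativeBounded (0 : R) (1 : R)) : closed_subset (R * R)%type :=
  ClosedSubset (@diagonal_support_closed R F).

(* Main.v *)
Require Import Defs.
From HB Require Import structures.
From mathcomp Require Import all_boot all_order all_algebra.
From mathcomp Require Import finmap.
From mathcomp Require Import all_classical all_reals all_analysis.
From mathcomp Require Import measurable_realfun.
From mathcomp Require Import lra.

Set Implicit Arguments.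
Unset Strict Implicit.
Unset Printing Implicit Defensive.

Import Order.TTheory GRing.Theory Num.Theory.
Import numFieldNormedType.Exports.

Local Open Scope classical_set_scope.
Local Open Scope ring_scope.

(** With high probability the empirical distribution function of the sample at a
    fixed point [t] is close to [F t]; this is the weak law of large numbers
    [whp_count_le], proved by Chebyshev's inequality.
    The identities [order_statistic_le] and [quantile_le] turn a comparison of an
    order statistic with [t], respectively of a quantile with [t], into one of a
    rank with the number of observations up to [t], respectively with [F t].  So
    if [F u < F v], the plot meets neither the quadrant [x < u, v < y] nor the
    quadrant [v < x, y < u] ([whp_miss_above], [whp_miss_below]), and it has a
    point in the square [`]u, v] * `]u, v]] ([whp_hit]).

    A point [x] is in the support exactly when [F] separates [x - e] from [x + e]
    for every [e > 0] ([cdf_supportP]), so the plot enters every neighbourhood of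
    [(x, x)].  Conversely, a point off the limit has a neighbourhood that the plot
    avoids ([whp_miss]).  Off the diagonal, [F] either separates two levels
    between the coordinates, and a quadrant is avoided, or is constant between
    them.  In the latter case the constant is 0 or 1 ([cdf_flat]): otherwise the
    two ends of the flat piece would be points of the support with the same value
    of [F], by continuity, against strict monotonicity.  Where [F] is 0 or 1 there
    is almost surely no observation beyond, and the plot stays away.  A diagonal
    point off the support lies inside a flat piece and is treated in the same way.

    The events of asymptotic probability one form a filter [whp], and convergence
    in the Fell topology along a filter may be tested on the subbase ([fell_cvg]);
    for a compact set, the neighbourhoods avoided by the plot are combined by
    compactness.  Convergence in probability for [d] also asks for measurability:
    the plot depends continuously on the sample ([qq_plot_cvg]), and an open set
    of samples is a countable union of rational boxes
    ([measurable_open_sample]). *)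

(** * Convergence in the Fell topology *)

(** The neighbourhoods of the limit are generated by finite intersections of
    subbasic sets, so a filter converges once it contains the latter. *)
Lemma fell_cvg (T : topologicalType) (G : set_system (closed_subset T))
    (A : closed_subset T) : Filter G ->
  (forall K, compact K -> fell_miss K A -> G (fell_miss K)) ->
  (forall U, open U -> fell_hit U A -> G (fell_hit U)) ->
  G --> A.
Proof.
move=> FG missG hitG W; rewrite nbhsE => -[_ [[B sB <-] [C BC CA]] sUW].
apply: filterS sUW _; apply: (@filterS _ _ _ C); first by move=> D CD; exists C.
have /sB[D sD IDC] := BC; rewrite -IDC; apply: filter_bigI => E DE.
have EA : E A by move: CA; rewrite -IDC; apply.
have /sD := DE; rewrite inE => -[[K cK KE]|[U oU UE]].
- by move: EA; rewrite -KE; exact: missG.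
- by move: EA; rewrite -UE; exact: hitG.
Qed.

(** * Order statistics *)

Section order_statistics.
Context {R : realType}.
Implicit Types (x y : nat -> R) (n i : nat).

(** The number of the first [n] values of [x] that are at most [t], that is, [n]
    times the empirical distribution function. *)
Definition count_le x n (t : R) : nat := count (fun s => s <= t) (mkseq x n).

(** Ranks are counted from 0: the [i]-th order statistic is at most [t] when at
    least [i + 1] values are. *)
Lemma order_statistic_le x n i t : (i < n)%N ->
  (order_statistic x n i <= t) = (i < count_le x n t)%N.
Proof.
move=> ltin; have srt : sorted <=%R (sort <=%R (mkseq x n)).
  by apply: sort_sorted; exact: le_total.
rewrite /count_le -(count_sort <=%R); apply/idP/idP => [|]; last first.
  exact: nth_count_le.
apply: contraLR; rewrite -leqNgt -ltNge => le_i.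
by apply: nth_count_gt; rewrite // le_i size_sort size_mkseq.
Qed.

Lemma count_le_leq x y n s t :
  (forall j, (j < n)%N -> x j <= s -> y j <= t) ->
  (count_le x n s <= count_le y n t)%N.
Proof.
move=> xy; rewrite /count_le /mkseq !count_map -!size_filter.
rewrite uniq_leq_size ?filter_uniq ?iota_uniq// => j.
by rewrite !mem_filter mem_iota add0n /= => /andP[xs jn]; rewrite xy.
Qed.

Lemma count_le_eq0 x n t :
  (forall j, (j < n)%N -> t < x j) -> count_le x n t = 0%N.
Proof.
move=> tx; apply/eqP; rewrite -leqn0 leqNgt -has_count -all_predC.
by apply/allP => _ /mapP[j + ->]; rewrite mem_iota /= -ltNge => /tx.
Qed.

Lemma count_le_eqn x n t :
  (forall j, (j < n)%N -> x j <= t) -> count_le x n t = n.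
Proof.
move=> xt; rewrite -[RHS](size_mkseq x); apply/eqP; rewrite -all_count.
by apply/allP => _ /mapP[j + ->]; rewrite mem_iota => /xt.
Qed.

(** Taking order statistics is nonexpansive for the uniform distance. *)
Lemma order_statistic_dist x y n i e : (i < n)%N ->
  (forall j, (j < n)%N -> `|x j - y j| <= e) ->
  `|order_statistic x n i - order_statistic y n i| <= e.
Proof.
move=> ltin xy.
suff H x' y' : (forall j, (j < n)%N -> `|x' j - y' j| <= e) ->
    order_statistic x' n i <= order_statistic y' n i + e.
  rewrite ler_distlC lerBlDr !H// => j ltjn; by rewrite distrC xy.
move=> xy'; rewrite order_statistic_le//.
apply: (@leq_trans (count_le y' n (order_statistic y' n i))).
  by rewrite -order_statistic_le.
by apply: count_le_leq => j /xy'; rewrite ler_distlC; lra.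
Qed.

End order_statistics.

(** * Measurability of the Q-Q plot *)

(** The neighbourhoods of [x] for the uniform distance of the first [n] values;
    the other values are left free. *)
Definition nbhs_sample {R : realType} (n : nat) (x : nat -> R) :
    set_system (nat -> R) :=
  filter_from [set e : R | 0 < e]
    (fun e => [set y | forall j, (j < n)%N -> `|x j - y j| < e]).

#[local] Instance nbhs_sample_filter {R : realType} n (x : nat -> R) :
  Filter (nbhs_sample n x).
Proof.
apply: filter_from_filter; first by exists 1; exact: ltr01.
move=> d e d0 e0; exists (Num.min d e); first by rewrite /= lt_min d0.
by move=> y xy; split=> j /xy; rewrite lt_min => /andP[].
Qed.

Lemma order_statistic_cvg {R : realType} n i (x : nat -> R) : (i < n)%N ->
  order_statistic y n i @[y --> nbhs_sample n x] --> order_statistic x n i.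
Proof.
move=> ltin; apply/cvgrPdist_le => e e0; exists e => // y xy.
by apply: order_statistic_dist => // j /xy/ltW.
Qed.

Lemma qq_plot_cvg {R : realType} (F : R -> R) n (x : nat -> R) :
  qq_plot F y n @[y --> nbhs_sample n x] --> qq_plot F x n.
Proof.
pose pt (y : nat -> R) i := (quantile F (i.+1%:R / n.+1%:R), order_statistic y n i).
have ptcvg i : (i < n)%N -> pt y i @[y --> nbhs_sample n x] --> pt x i.
  move=> ltin; apply: (@cvg_pair _ _ _ _ (nbhs _) (nbhs _)).
    exact: cvg_cst.
  exact: order_statistic_cvg.
apply: fell_cvg => [K cK /= Kx|U oU [_ [[i /= ltin <-]] Ui]]; last first.
  rewrite /nbhs /=; near=> y; exists (pt y i); split; first by exists i.
  by near: y; apply: (ptcvg i ltin); exact: open_nbhs_nbhs.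
have clK : closed K by apply: compact_closed => //; exact: norm_hausdorff.
suff : \forall y \near nbhs_sample n x, forall i : 'I_n, (~` K) (pt y i).
  apply: filterS => y Ky; rewrite /fell_miss/= -subset0 => z [[i /= ltin <-]].
  exact: Ky (Ordinal ltin).
apply: filter_forall => i; apply: (ptcvg i (ltn_ord i)).
apply: open_nbhs_nbhs; split; first exact: closed_openC.
move=> Ki; suff : (qq_points F x n `&` K) (pt x i) by rewrite Kx.
by split; first by exists i => /=.
Unshelve. all: end_near. Qed.

(** An open set of samples is a countable union of boxes with rational centres
    and radii. *)
Lemma measurable_open_sample disp (Omega : measurableType disp) (R : realType)
    (X : nat -> Omega -> R) n (W : set (nat -> R)) :
  (forall i, measurable_fun setT (X i)) ->
  (forall x, W x -> nbhs_sample n x W) ->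
  measurable [set w | W (X ^~ w)].
Proof.
move=> mX oW.
pose box (c : nat * seq rat) : set (nat -> R) :=
  [set x | forall j, (j < n)%N -> `|ratr c.2`_j - x j| < c.1.+1%:R^-1].
pose B c := [set w | box c `<=` W /\ box c (X ^~ w)].
have -> : [set w | W (X ^~ w)] = \bigcup_(c in setT) B c.
  apply/seteqP; split => [w /= Ww|w [c _ []]]; last by move=> + bw; apply.
  have [e /= e0 eW] := oW _ Ww.
  (* a box of radius 1/(k+1) around a point within 1/(k+1) of the sample *)
  have [k ke] : exists k, k.+1%:R^-1 + k.+1%:R^-1 < e :> R.
    near \oo => k; exists k; rewrite [e]splitr.
    by apply: ltrD; near: k; apply: near_infty_natSinv_lt (PosNum (divr_gt0 e0 _)).
  have q j : exists q : rat, `|ratr q - X j w| < k.+1%:R^-1.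
    have [|q] := @rat_in_itvoo _ (X j w - k.+1%:R^-1) (X j w + k.+1%:R^-1).
      by rewrite ltrD2l gtrN.
    by rewrite in_itv/= => qX; exists q; rewrite ltr_distl.
  have [c cX] := choice q.
  have cnth j : (j < n)%N -> (mkseq c n)`_j = c j by move=> ?; rewrite nth_mkseq.
  exists (k, mkseq c n) => //; split=> [x xc|j ltjn /=]; last by rewrite cnth.
  apply: eW => j ltjn; have := xc j ltjn; rewrite /= cnth// => xcj.
  rewrite (le_lt_trans (ler_distD (ratr (c j)) _ _))//.
  by rewrite (lt_trans _ ke)// ltrD// distrC.
apply: countable_bigcupT_measurable => // c.
have [bW|nbW] := pselect (box c `<=` W); last first.
  by rewrite (_ : B c = set0)// -subset0 => w [].
have -> : B c = \bigcap_(j in `I_n) [set w | `|ratr c.2`_j - X j w| < c.1.+1%:R^-1].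
  by apply/seteqP; split=> [w []|w].
apply: bigcap_measurableType => j _.
have := mX j measurableT _ (measurable_itv
  `](ratr c.2`_j - c.1.+1%:R^-1), (ratr c.2`_j + c.1.+1%:R^-1)[).
by rewrite setTI; congr measurable; apply/funext => w /=; rewrite in_itv/= -ltr_distlC.
Unshelve. all: end_near. Qed.

(** * Events of asymptotic probability one *)

(** The filter on [nat * Omega] of the events [A] depending on a sample size
    such that the complement of [A] at size [n] is contained in an event whose
    probability tends to 0.  Measurability is only asked of this bound, so that
    the complements themselves may be unions over uncountable families. *)
Definition whp disp (Omega : measurableType disp) (R : realType)
    (P : probability Omega R) : set_system (nat * Omega) :=
  [set A | exists N : nat -> set Omega, [/\ forall n, measurable (N n),
    P (N n) @[n --> \oo] --> 0%E &
    \forall n \near \oo, forall w, A (n, w) \/ N n w]].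

#[local] Instance whp_filter disp (Omega : measurableType disp) (R : realType)
  (P : probability Omega R) : Filter (whp P).
Proof.
split.
- exists (fun=> set0); split=> //.
    by under eq_fun do rewrite measure0; exact: cvg_cst.
  by apply: nearW => n w; left.
- move=> A B [M [mM M0 AM]] [N [mN N0 BN]]; exists (fun n => M n `|` N n).
  split=> [n||]; first exact: measurableU.
  + apply: (@squeeze_cvge _ _ _ _ (cst 0%E) _ (fun n => P (M n) + P (N n))%E).
    * by apply: nearW => n; rewrite measure_ge0/= measureU2.
    * exact: cvg_cst.
    * by rewrite -[X in _ --> X]adde0; exact: cvgeD.
  + near=> n => w.
    have AMn : forall w, A (n, w) \/ M n w by near: n.
    have BNn : forall w, B (n, w) \/ N n w by near: n.
    case: (AMn w) => ?; last by right; left.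
    by case: (BNn w) => ?; [left|right; right].
- move=> A B AB [N [mN N0 AN]]; exists N; split=> //.
  by apply: filterS AN => n AN w; case: (AN w) => [/AB|]; [left|right].
Unshelve. all: end_near. Qed.

Lemma whp_near disp (Omega : measurableType disp) (R : realType)
    (P : probability Omega R) (A : set (nat * Omega)) :
  (\forall n \near \oo, forall w, A (n, w)) -> whp P A.
Proof.
move=> An; exists (fun=> set0); split=> //.
  by under eq_fun do rewrite measure0; exact: cvg_cst.
by apply: filterS An => n An w; left.
Qed.

(** * The weak law of large numbers for events *)

(** Only pairwise independence of the events is used. *)
Section weak_law.
Context disp (Omega : measurableType disp) (R : realType).
Variables (P : probability Omega R) (A : nat -> set Omega) (p : R).
Hypothesis mA : forall i, measurable (A i).
Hypothesis PA : forall i, P (A i) = p%:E.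
Hypothesis indepA : forall i j : nat, i != j -> P (A i `&` A j) = (p * p)%:E.

(** The number of events among the first [n] that occur. *)
Let S n : Omega -> R := \sum_(i < n) \1_(A i).

Let Lfun_indic i : (\1_(A i) : Omega -> R) \in Lfun P 2%:E.
Proof.
rewrite inE/=; apply/andP; split; rewrite inE//=.
rewrite /finite_norm unlock poweR_lty//.
under eq_integral => w _ /=.
  rewrite (_ : `|\1_(A i) w| `^ 2 = \1_(A i) w); first over.
  by rewrite indicE; case: (w \in A i); rewrite ?normr1 ?powR1// normr0 powR0.
by rewrite integral_indic// setIT (le_lt_trans (probability_le1 P _))// ltry.
Qed.

Let Lfun_S n : S n \in Lfun P 2%:E.
Proof. by apply: rpred_sum; rewrite ?lee1n// => i _; exact: Lfun_indic. Qed.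

Let covariance_indic (i j : nat) : i != j -> covariance P \1_(A i) \1_(A j) = 0%E.
Proof.
have Pfin : P setT \is a fin_num := fin_num_measure P _ measurableT.
move=> ij; rewrite covarianceE ?Lfun2_mul_Lfun1 ?(Lfun_subset12 Pfin)//.
rewrite -[X in expectation _ X]/(\1_(A i) \* \1_(A j)) -indicI.
rewrite !expectation_indic//; last exact: measurableI.
by rewrite indepA// !PA EFinM subee.
Qed.

Let variance_S n : ('V_P[S n] <= n%:R%:E)%E.
Proof.
elim: n => [|n IHn]; first by rewrite /S big_ord0 (variance_cst P 0).
have Pfin : P setT \is a fin_num := fin_num_measure P _ measurableT.
have cov0 m : (m <= n)%N -> covariance P (S m) \1_(A n) = 0%E.
  elim: m => [_|m IHm lt_mn].
    by rewrite /S big_ord0 (covariance_cst_l P 0).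
  rewrite /S big_ord_recr/= (covarianceDl (Lfun_S m))//.
  rewrite covariance_indic ?IHm ?adde0//; first exact: ltnW.
  by rewrite neq_ltn lt_mn.
rewrite /S big_ord_recr/= (varianceD (Lfun_S n))// cov0// mule0 adde0.
rewrite -natr1 EFinD leeD// varianceE// (_ : \1_(A n) ^+ 2 = \1_(A n)); last first.
  by rewrite expr2 -[LHS]/(\1_(A n) \* \1_(A n)) -indicI setIid.
by rewrite expectation_indic// PA -EFin_expe -EFinB lee_fin; nra.
Qed.

Let expectation_S n : ('E_P[S n])%E = (n%:R * p)%:E.
Proof.
have Pfin : P setT \is a fin_num := fin_num_measure P _ measurableT.
elim: n => [|n IHn]; first by rewrite /S big_ord0 (expectation_cst P 0) mul0r.
rewrite /S big_ord_recr/= (expectationD (Lfun_subset12 Pfin (Lfun_S n))); last first.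
  exact: Lfun_subset12.
by rewrite IHn expectation_indic// PA -EFinD -natr1 mulrDl mul1r.
Qed.

Lemma whp_weak_law e : 0 < e ->
  whp P [set z | `|S z.1 z.2 - z.1%:R * p| < z.1%:R * e].
Proof.
move=> e0.
have mS n : measurable_fun setT (S n).
  by have /andP[] := Lfun_S n; rewrite inE.
pose N n := [set w | n%:R * e <= `|S n w - n%:R * p|].
have PN n : (0 < n)%N -> (P (N n) <= (e ^- 2 * n%:R^-1)%:E)%E.
  move=> n0; pose Y : {RV P >-> R} := mfun_Sub (mem_set (mS n)).
  have ne0 : 0 < n%:R * e by rewrite mulr_gt0 ?ltr0n.
  have := chebyshev Y ne0; rewrite /= expectation_S/= => /le_trans; apply.
  apply: (@le_trans _ _ (((n%:R * e) ^- 2)%:E * n%:R%:E)%E).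
    by rewrite lee_pmul2l// ?lte_fin ?invr_gt0 ?exprn_gt0.
  rewrite -EFinM lee_fin exprMn invfM mulrC mulrA expr2 invfM mulrA divff.
    by rewrite mul1r mulrC.
  by rewrite pnatr_eq0 -lt0n.
exists N; split=> [n||].
- have : measurable_fun setT (fun w => `|S n w - n%:R * p|).
    by apply: measurableT_comp => //; exact: measurable_funB.
  move=> /(_ measurableT _ (measurable_itv `[(n%:R * e), +oo[)).
  rewrite setTI; congr measurable.
  by apply/funext => w /=; rewrite in_itv/= andbT.
- apply: (@squeeze_cvge _ _ _ _ (cst 0%E) _ (fun n => (e ^- 2 * n%:R^-1)%:E)).
  + near=> n; rewrite measure_ge0/= PN//; near: n; exact: nbhs_infty_gt.
  + exact: cvg_cst.
  + apply: cvg_EFin; first by apply: nearW.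
    rewrite -[X in _ --> X](mulr0 (e ^- 2)); apply: cvgMr.
    apply/gtr0_cvgV0; last exact: cvgr_idn.
    by near=> n; rewrite ltr0n; near: n; exact: nbhs_infty_gt.
- apply: nearW => n w /=.
  by case: (ltP `|S n w - n%:R * p| (n%:R * e)); [left|right].
Unshelve. all: end_near. Qed.

End weak_law.

(** * Quantiles and support of a distribution function *)

Section distribution_function.
Context {R : realType} (F : cumulativeBounded (0 : R) (1 : R)).

Let ndF : {homo F : x y / x <= y} := cumulative_is_nondecreasing F.

Lemma cumulative_lt_ex c : 0 < c -> exists x, F x < c.
Proof.
move=> c0; have /filter_ex[x] : \forall x \near -oo, F x < c; last by exists x.
exact: cvgr_lt _ (cumulativeNy F) _ c0.
Qed.

Lemma cumulative_gt_ex c : c < 1 -> exists x, c < F x.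
Proof.
move=> c1; have /filter_ex[x] : \forall x \near +oo, c < F x; last by exists x.
exact: cvgr_gt _ (cumulativey F) _ c1.
Qed.

Lemma cumulative_ge0 x : 0 <= F x.
Proof.
rewrite leNgt; apply/negP => Fx0.
have /filter_ex[y [yx]] : \forall y \near -oo, y <= x /\ F x < F y.
  near=> y; split; near: y; first exact: nbhs_ninfty_le.
  exact: cvgr_gt _ (cumulativeNy F) _ Fx0.
by rewrite ltNge ndF.
Unshelve. all: end_near. Qed.

Lemma cumulative_le1 x : F x <= 1.
Proof.
rewrite leNgt; apply/negP => Fx1.
have /filter_ex[y [xy]] : \forall y \near +oo, x <= y /\ F y < F x.
  near=> y; split; near: y; first exact: nbhs_pinfty_ge.
  exact: cvgr_lt _ (cumulativey F) _ Fx1.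
by rewrite ltNge ndF.
Unshelve. all: end_near. Qed.

(** The quantile function and the distribution function form a Galois
    connection; right continuity makes the infimum a minimum. *)
Lemma quantile_le p x : 0 < p < 1 -> (quantile F p <= x) = (p <= F x).
Proof.
move=> /andP[p0 p1].
have lbp y z : F y < p -> p <= F z -> y <= z.
  move=> yp pz; rewrite leNgt; apply/negP => /ltW/ndF.
  by rewrite leNgt (lt_le_trans yp).
have infp : has_inf [set y | p <= F y].
  split; first by have [y /ltW] := cumulative_gt_ex p1; exists y.
  by have [y yp] := cumulative_lt_ex p0; exists y => z /= ; exact: lbp.
apply/idP/idP => [qx|px]; last by apply: ge_inf => //; case: infp.
rewrite leNgt; apply/negP => Fxp.
have /filter_ex[y [Fyp qy]] :
    \forall y \near x^'+, F y < p /\ quantile F p < y.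
  near=> y; split; last by rewrite (le_lt_trans qx).
  near: y; exact: cvgr_lt _ (cumulative_is_right_continuous F x) _ Fxp.
have [|z pz zy] := @inf_adherent _ _ (y - quantile F p) _ infp.
  by rewrite subr_gt0.
by move: zy; rewrite -/(quantile F p) subrKC ltNge lbp.
Unshelve. all: end_near. Qed.

Lemma quantile_gt p x : 0 < p < 1 -> (x < quantile F p) = (F x < p).
Proof. by move=> p01; rewrite !ltNge quantile_le. Qed.

Lemma cdf_supportP x :
  cdf_support F x <-> forall e, 0 < e -> F (x - e) < F (x + e).
Proof.
have lsE u v : u <= v ->
    lebesgue_stieltjes_measure F `]u, v]%classic = (F v - F u)%:E.
  move=> uv; rewrite /lebesgue_stieltjes_measure /measure_extension.
  by rewrite measurable_mu_extE/=; [rewrite wlength_itv_bnd|exact: is_ocitv].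
pose mu : probability (measurableTypeR R) R := lebesgue_stieltjes_measure F.
split=> [Sx e e0|Fe C [clC C1]].
- have lee : x - e <= x + e by lra.
  rewrite lt_neqAle ndF// andbT; apply/negP => /eqP Fe.
  have := Sx (~` `](x - e), (x + e)[%classic); apply; last first.
    by rewrite /= in_itv/=; lra.
  split; first exact/open_closedC/interval_open.
  rewrite -[LHS]/(mu _) probability_setC; last exact: measurable_itv.
  suff -> : mu `](x - e), (x + e)[%classic = 0%E by rewrite sube0.
  apply/eqP; rewrite eq_le measure_ge0 andbT.
  have -> : 0%E = mu `](x - e), (x + e)]%classic by rewrite /mu/= lsE// Fe subrr.
  apply: le_measure; rewrite ?inE; try exact: measurable_itv.
  exact: subset_itvW.
- have mC : measurable (C : set (measurableTypeR R)) := closed_measurable clC.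
  apply: contrapT => nCx.
  have [e /= e0 eC] : nbhs x (~` C).
    by apply: open_nbhs_nbhs; split => //; exact: closed_openC.
  have := Fe (e / 2); rewrite divr_gt0// => /(_ isT); rewrite ltNge => /negP.
  apply.
  have le2 : x - e / 2 <= x + e / 2 by lra.
  rewrite -subr_le0 -lee_fin -lsE//.
  apply: (@le_trans _ _ (mu (~` C))); last first.
    by rewrite probability_setC ?[mu C]C1 ?subee.
  apply: le_measure; rewrite ?inE.
  + exact: measurable_itv.
  + exact: measurableC.
  + move=> y /=; rewrite in_itv/= => ye; apply: eC.
    by rewrite /ball/= ltr_distlC; lra.
Qed.

(** The only flat pieces of [F] are at the levels 0 and 1.  Only continuity at
    the right end of the piece is needed, as [F] is right continuous. *)
Lemma cdf_flat u v :
  (forall x y, cdf_support F x -> cdf_support F y -> x < y -> F x < F y) ->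
  (forall x, cdf_support F x -> {for x, continuous F}) ->
  u < v -> F u = F v -> F u = 0 \/ F u = 1.
Proof.
move=> incrF contF uv Fuv.
have [->|Fu0] := eqVneq (F u) 0; first by left.
have [->|Fu1] := eqVneq (F u) 1; first by right.
have p01 : 0 < F u < 1.
  by rewrite !lt_neqAle eq_sym Fu0 cumulative_ge0 Fu1 cumulative_le1.
have [p0 p1] := andP p01.
(* [q] and [s] are the ends of the set where [F] takes the value [F u]. *)
pose q := quantile F (F u); pose E := [set x | F x <= F u]; pose s := sup E.
have supE : has_sup E.
  split; first by exists u; rewrite /E /=.
  have [y yp] := cumulative_gt_ex p1; exists y => z /= zp.
  by rewrite leNgt; apply/negP => /ltW/ndF; rewrite leNgt (le_lt_trans zp).
have gts x : s < x -> F u < F x.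
  move=> sx; rewrite ltNge; apply/negP => Ex; move: sx.
  by rewrite ltNge ub_le_sup//; case: supE.
have lts x : x < s -> F x <= F u.
  move=> xs; have [|y Ey] := @sup_adherent _ _ (s - x) _ supE; first by rewrite subr_gt0.
  by rewrite -/s subKr => /ltW/ndF xy; exact: le_trans xy Ey.
have Sq : cdf_support F q.
  apply/cdf_supportP => e e0; apply: (@lt_le_trans _ _ (F u)).
    by rewrite -quantile_gt// -/q ltrBlDr ltrDl.
  by rewrite -quantile_le// -/q lerDl ltW.
have Ss : cdf_support F s.
  apply/cdf_supportP => e e0; apply: (@le_lt_trans _ _ (F u)).
    by apply: lts; rewrite ltrBlDr ltrDl.
  by apply: gts; rewrite ltrDl.
have qs : q < s.
  apply: (@le_lt_trans _ _ u); first by rewrite quantile_le.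
  apply: (lt_le_trans uv); apply: ub_le_sup; first by case: supE.
  by rewrite /E /= Fuv.
have Fs : F u < F s.
  by apply: le_lt_trans (incrF _ _ Sq Ss qs); rewrite -quantile_le.
have /filter_ex[y [uy ys]] : \forall y \near s^'-, F u < F y /\ y < s.
  near=> y; split; last by [].
  near: y; apply: cvgr_gt _ _ _ Fs; exact/cvg_at_left_filter/contF.
by move: uy; rewrite ltNge lts.
Unshelve. all: end_near. Qed.

End distribution_function.
(** * Empirical distribution function and Q-Q plot of an iid sample *)

Section iid_sample.
Context disp (Omega : measurableType disp) (R : realType).
Context (P : probability Omega R) (X : nat -> {RV P >-> R}).
Variable F : cumulativeBounded (0 : R) (1 : R).
Hypothesis iidX : iid_with_cdf X F.

Local Notation sample z := (fun i => X i z.2).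
Local Notation level n i := (i.+1%:R / n.+1%:R : R).
Local Notation q n i := (quantile F (level n i)).

Let P_le i t : P [set w | X i w <= t] = (F t)%:E.
Proof.
by rewrite -(proj2 iidX i t) /cdf /distribution /pushforward; congr (P _).
Qed.

Let measurable_le i t : measurable [set w | X i w <= t].
Proof.
rewrite (_ : [set _ | _] = X i @^-1` `]-oo, t]); last first.
  by apply/funext => w; rewrite /= in_itv.
exact: measurable_funPTI.
Qed.

Lemma whp_count_le t e : 0 < e ->
  whp P [set z | `|(count_le (sample z) z.1 t)%:R - z.1%:R * F t| < z.1%:R * e].
Proof.
move=> e0; have indep i j : i != j ->
    P ([set w | X i w <= t] `&` [set w | X j w <= t]) = (F t * F t)%:E.
  move=> ij; have itvE k : X k @^-1` `]-oo, t] = [set w | X k w <= t].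
    by apply/funext => w; rewrite /= in_itv.
  have := proj1 iidX [fset i; j]%fset (fun=> `]-oo, t]%classic).
  rewrite big_fsetU1 ?inE//= big_seq_fset1 !itvE !P_le -EFinM => <-; last by [].
  congr (P _); apply/seteqP; split=> [w [wi wj] k|w wij].
    by rewrite /= !inE => /orP[] /eqP ->.
  by split; rewrite -itvE; apply: wij; rewrite /= !inE eqxx ?orbT.
have := whp_weak_law (fun i => measurable_le i t) (P_le^~ t) indep e0.
apply: filterS => -[n w] /=; congr (is_true (`|_ - _| < _)).
elim: n => [|n IHn]; first by rewrite big_ord0.
rewrite big_ord_recr /= /count_le /mkseq -addn1 iotaD map_cat count_cat natrD.
rewrite -[X in _ = X + _]IHn /= add0n addn0; congr (_ + _).
by rewrite indicE; congr (_%:R); congr nat_of_bool; apply/asboolP/idP.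
Qed.

Let level_itv n i : (i < n)%N -> 0 < level n i < 1.
Proof.
by move=> ltin; rewrite divr_gt0 ?ltr0n//= ltr_pdivrMr ?ltr0n// mul1r ltr_nat ltnS.
Qed.

(** The plot does not enter a quadrant lying off the diagonal and cut at levels
    [u] and [v] that [F] separates. *)
Lemma whp_miss_above u v : F u < F v ->
  whp P [set z | forall i, (i < z.1)%N ->
    ~ (q z.1 i < u /\ v < order_statistic (sample z) z.1 i)].
Proof.
move=> Fuv; have e0 : 0 < (F v - F u) / 2 by lra.
apply: filterS (whp_count_le v e0) => -[n w] /= cv i ltin [/ltW qu].
rewrite quantile_le ?level_itv// ler_pdivrMr ?ltr0n// in qu.
rewrite ltNge order_statistic_le// -leqNgt -(ler_nat R) => ci.
move: cv qu ci; rewrite ltr_distl => /andP[cv _].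
rewrite -!natr1 => qu ci; have := cumulative_le1 F u; have := ler0n R n; nra.
Qed.

Lemma whp_miss_below u v : F u < F v ->
  whp P [set z | forall i, (i < z.1)%N ->
    ~ (v < q z.1 i /\ order_statistic (sample z) z.1 i < u)].
Proof.
move=> Fuv; have e0 : 0 < (F v - F u) / 2 by lra.
apply: filterS (whp_count_le u e0) => -[n w] /= cu i ltin [qv /ltW].
rewrite quantile_gt ?level_itv// ltr_pdivlMr ?ltr0n// in qv.
rewrite order_statistic_le// -(ler_nat R) => ci.
move: cu qv ci; rewrite ltr_distl => /andP[_ cu].
rewrite -!natr1 => qv ci; have := cumulative_ge0 F v; have := ler0n R n; nra.
Qed.

Lemma whp_ae (A : nat -> set Omega) : (forall j, {ae P, forall w, A j w}) ->
  whp P [set z | forall j, A j z.2].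
Proof.
move=> /ae_foralln[N [mN N0 AN]]; exists (fun=> N); split=> //.
  by rewrite N0; exact: cvg_cst.
apply: nearW => n w /=; have [Aw|nAw] := pselect (forall j, A j w).
  by left.
by right; exact: AN.
Qed.

(** Where [F] vanishes there are almost surely no observations. *)
Lemma whp_gt m : F m = 0 -> whp P [set z | forall i, (i < z.1)%N ->
  m < q z.1 i /\ m < order_statistic (sample z) z.1 i].
Proof.
move=> Fm; have : forall j, {ae P, forall w, m < X j w}.
  move=> j; exists [set w | X j w <= m]; split=> //; first by rewrite P_le Fm.
  by move=> w /= /negP; rewrite -leNgt.
move=> /whp_ae; apply: filterS => -[n w] /= mX i ltin; split.
  by rewrite quantile_gt ?level_itv// Fm; case/andP: (level_itv ltin).
by rewrite ltNge order_statistic_le// count_le_eq0.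
Qed.

Lemma whp_le m : F m = 1 -> whp P [set z | forall i, (i < z.1)%N ->
  q z.1 i <= m /\ order_statistic (sample z) z.1 i <= m].
Proof.
move=> Fm; have : forall j, {ae P, forall w, X j w <= m}.
  move=> j; exists (~` [set w | X j w <= m]); split=> //.
    exact: measurableC.
  by rewrite probability_setC// P_le Fm subee.
move=> /whp_ae; apply: filterS => -[n w] /= mX i ltin; split.
  by rewrite quantile_le ?level_itv// Fm ltW//; case/andP: (level_itv ltin).
by rewrite order_statistic_le// count_le_eqn.
Qed.

(** The plot has a point in the square over each interval charged by [F]. *)
Lemma whp_hit u v : F u < F v ->
  whp P [set z | exists2 i, (i < z.1)%N &
    u < q z.1 i <= v /\ u < order_statistic (sample z) z.1 i <= v].
Proof.
move=> Fuv; have e0 : 0 < (F v - F u) / 4 by lra.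
have large : whp P [set z | 4 / (F v - F u) <= z.1%:R].
  by apply: whp_near; near=> n => w /=; near: n; exact: nbhs_infty_ger.
apply: filterS3 (whp_count_le u e0) (whp_count_le v e0) large => -[n w] /=.
rewrite !ltr_distl => /andP[_ cu] /andP[cv _].
rewrite ler_pdivrMr ?subr_gt0// => nlarge.
(* The level [(i + 1) / (n + 1)] is just above the middle [g] of [F u] and
   [F v], while the errors of the empirical distribution function are below a
   quarter of [F v - F u]. *)
pose g := (F u + F v) / 2; pose i := Num.truncn (n.+1%:R * g).
have Fu0 := cumulative_ge0 F u; have Fv1 := cumulative_le1 F v.
have /andP[iL iU] : i%:R <= n.+1%:R * g < i.+1%:R.
  by apply: truncn_itv; rewrite mulr_ge0// /g; lra.
rewrite -!natr1 in iL iU; have n0 := ler0n R n.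
have icv : (i < count_le (fun j => X j w) n v)%N.
  by rewrite -(ltr_nat R); rewrite /g in iL; nra.
have cui : (count_le (fun j => X j w) n u <= i)%N.
  by rewrite -ltnS -(ltr_nat R) -natr1; rewrite /g in iU; nra.
have ltin : (i < n)%N.
  apply: leq_trans icv _.
  by rewrite -[leqRHS](size_mkseq (fun j => X j w)) count_size.
exists i => //; rewrite /g in iL iU.
have -> : u < order_statistic (fun j => X j w) n i.
  by rewrite ltNge order_statistic_le// -leqNgt.
rewrite order_statistic_le// icv quantile_gt ?quantile_le ?level_itv//.
rewrite ltr_pdivlMr ?ler_pdivrMr ?ltr0n// -!natr1.
by split=> //; apply/andP; split; lra.
Unshelve. all: end_near. Qed.

End iid_sample.

(** * Convergence of the Q-Q plot *)

Section qq_plot_convergence.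
Context disp (Omega : measurableType disp) (R : realType).
Context (P : probability Omega R) (X : nat -> {RV P >-> R}).
Variable F : cumulativeBounded (0 : R) (1 : R).
Hypothesis iidX : iid_with_cdf X F.
Hypothesis incrF : forall x y : R, cdf_support F x -> cdf_support F y ->
  x < y -> F x < F y.
Hypothesis contF : forall x : R, cdf_support F x -> {for x, continuous F}.

Let ndF : {homo F : x y / x <= y} := cumulative_is_nondecreasing F.

Local Notation Y z := (qq_points F (fun i => X i z.2) z.1).
Local Notation q n i := (quantile F (i.+1%:R / n.+1%:R)).

Let miss_box (a b : R) (A B : set R) : nbhs a A -> nbhs b B ->
  whp P [set z | forall i, (i < z.1)%N ->
    ~ (A (q z.1 i) /\ B (order_statistic (fun i => X i z.2) z.1 i))] ->
  \forall c \near (a, b) & z \near whp P, ~ Y z c.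
Proof.
move=> aA bB AB; exists (A `*` B, [set z | forall i, (i < z.1)%N ->
    ~ (A (q z.1 i) /\ B (order_statistic (fun i => X i z.2) z.1 i))]).
  by split=> //; exists (A, B).
move=> [c z] /= [[Ac Bc] zAB] [i /= ltin ci].
by apply: (zAB i ltin); move: Ac Bc; rewrite -ci.
Qed.

(** Where [F] takes only the value 0 or only the value 1, it is the range of the
    sample, not the law of large numbers, that keeps the plot away. *)
Let miss_flat (a b u v : R) : u < v -> F u = F v ->
  (a < v \/ b < v) -> (u < a \/ u < b) ->
  \forall c \near (a, b) & z \near whp P, ~ Y z c.
Proof.
move=> uv Fuv abv uab; have [F0|F1] := cdf_flat incrF contF uv Fuv.
- rewrite Fuv in F0; have ge := whp_gt iidX F0; case: abv => [av|bv].
  + apply: (miss_box (lt_nbhsl av) filterT); apply: filterS ge => z vz i ltin.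
    by have [/ltW vq _] := vz i ltin; rewrite ltNge vq => -[].
  + apply: (miss_box filterT (lt_nbhsl bv)); apply: filterS ge => z vz i ltin.
    by have [_ /ltW vX] := vz i ltin; rewrite ltNge vX => -[].
- have le := whp_le iidX F1; case: uab => [ua|ub].
  + apply: (miss_box (lt_nbhsr ua) filterT); apply: filterS le => z zu i ltin.
    by have [qu _] := zu i ltin; rewrite ltNge qu => -[].
  + apply: (miss_box filterT (lt_nbhsr ub)); apply: filterS le => z zu i ltin.
    by have [_ Xu] := zu i ltin; rewrite ltNge Xu => -[].
Qed.

(** Every point off the limit has a neighbourhood that the plot avoids. *)
Lemma whp_miss (c : R * R) : ~ Defs.diagonal (cdf_support F) c ->
  \forall c' \near c & z \near whp P, ~ Y z c'.
Proof.
case: c => a b nTab; have [ab|ba|eqab] := ltgtP a b.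
- pose u := (2 * a + b) / 3; pose v := (a + 2 * b) / 3.
  have [au uv vb] : [/\ a < u, u < v & v < b] by rewrite /u /v; split; lra.
  have [Fuv|Fuv] := eqVneq (F u) (F v).
    apply: (miss_flat uv Fuv); first by left; exact: lt_trans uv.
    by right; exact: lt_trans vb.
  apply: (miss_box (lt_nbhsl au) (lt_nbhsr vb)); apply: (whp_miss_above iidX).
  by rewrite lt_neqAle Fuv ndF// ltW.
- pose u := (2 * b + a) / 3; pose v := (b + 2 * a) / 3.
  have [bu uv va] : [/\ b < u, u < v & v < a] by rewrite /u /v; split; lra.
  have [Fuv|Fuv] := eqVneq (F u) (F v).
    apply: (miss_flat uv Fuv); first by right; exact: lt_trans uv.
    by left; exact: lt_trans va.
  apply: (miss_box (lt_nbhsr va) (lt_nbhsl bu)); apply: (whp_miss_below iidX).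
  by rewrite lt_neqAle Fuv ndF// ltW.
- have [e e0 Fe] : exists2 e, 0 < e & F (a - e) = F (a + e).
    apply: contrapT => nFe; apply: nTab; exists a; last by rewrite eqab.
    apply/cdf_supportP => e e0; rewrite lt_neqAle ndF ?andbT; last by lra.
    by apply/negP => /eqP Fe; apply: nFe; exists e.
  by apply: (miss_flat (u := a - e) (v := a + e)) => //; [|left|left]; lra.
Qed.

Lemma qq_plot_cvg_whp :
  qq_plot F (fun i => X i z.2) z.1 @[z --> whp P] --> diagonal_support F.
Proof.
apply: fell_cvg => [K cK KT|U oU [_ [[x Sx <-] Uxx]]].
- have : \forall z \near whp P, K `<=` [set c | ~ Y z c].
    apply: ((compact_near_coveringP K).1 cK _ _ (fun z c => ~ Y z c)) => c Kc.
    apply: whp_miss => Tc.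
    by suff : (Defs.diagonal (cdf_support F) `&` K) c by rewrite KT.
  apply: filterS => z KY; rewrite /fell_miss/= -subset0 => c [Yc Kc].
  exact: KY Kc Yc.
- have [[A B] /= [xA xB] ABU] : nbhs (x, x) U by exact: open_nbhs_nbhs.
  have [e /= e0 eAB] := filterI xA xB.
  have e2 : 0 < e / 2 by rewrite divr_gt0.
  have Fe := (cdf_supportP F x).1 Sx _ e2.
  apply: filterS (whp_hit iidX Fe) => -[n w] /= [i ltin [qi Xi]].
  exists (quantile F (i.+1%:R / n.+1%:R), order_statistic (fun i => X i w) n i).
  split; first by exists i.
  apply: ABU; split=> /=.
  - have [] // := eAB (quantile F (i.+1%:R / n.+1%:R)).
    by rewrite /ball/= ltr_distlC; lra.
  - have [] // := eAB (order_statistic (fun j => X j w) n i).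
    by rewrite /ball/= ltr_distlC; lra.
Qed.

End qq_plot_convergence.

Theorem proposition3p2 (disp : measure_display) (Omega : measurableType disp)
    (R : realType) (P : probability Omega R) (X : nat -> {RV P >-> R})
    (F : cumulativeBounded (0 : R) (1 : R))
    (iidX : iid_with_cdf X F)
    (incrF : forall x y : R, cdf_support F x -> cdf_support F y ->
      x < y -> F x < F y)
    (contF : forall x : R, cdf_support F x -> {for x, continuous F})
    (d : closed_subset (R * R)%type -> closed_subset (R * R)%type -> R)
    (metric_d : compatible_metric d) :
  cvg_in_probability P d
    (fun n w => qq_plot F (fun i => X i w) n) (diagonal_support F).
Proof.
move=> e e0; have [_ dC dD nbhs_d] := metric_d.
set T := diagonal_support F.
have mY n : measurable [set w | e <= d (qq_plot F (fun i => X i w) n) T].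
  rewrite (_ : [set _ | _] =
      ~` [set w | [set x | d (qq_plot F x n) T < e] (fun i => X i w)]); last first.
    by apply/seteqP; split=> w /=; rewrite leNgt => /negP.
  apply: measurableC; apply: (measurable_open_sample (n := n)) => [//|x /= xe].
  apply: (@qq_plot_cvg _ F n x [set A | d A T < e]).
  rewrite nbhs_d; exists (e - d (qq_plot F x n) T); first by rewrite /= subr_gt0.
  by move=> A /=; rewrite ltrBrDr dC => /(le_lt_trans _); apply.
split=> //.
have : \forall z \near whp P, d T (qq_plot F (fun i => X i z.2) z.1) < e.
  apply: (qq_plot_cvg_whp iidX incrF contF (t := [set A | d T A < e])).
  by rewrite nbhs_d; exists e.
move=> [N [mN N0 YN]].
apply: (@squeeze_cvge _ _ _ _ (cst 0%E) _ (P \o N)) => //; last exact: cvg_cst.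
near=> n; rewrite measure_ge0/= le_measure ?inE// => w /=.
rewrite leNgt dC => /negP nYe.
have dN : forall w, d T (qq_plot F (fun i => X i w) n) < e \/ N n w by near: n.
by case: (dN w).
Unshelve. all: end_near. Qed.
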